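(* For any integer $m\ge2$ we have $$\mathcal{H}(2^m,1)=\left(\sum_{j=1}^m\frac{2^{j-1}}{2^j-1}\right)\prod_{j=1}^m(2^j-1)^{2^{m-j}},$$ $$\mathcal{H}(2^m+1,1)=-\left(1+\sum_{j=1}^m\frac{2^{j-1}}{2^j-1}\right)\prod_{j=1}^m(2^j-1)^{2^{m-j}},$$ and $$\mathcal{H}(2^m-1,1)=(2^{m-1}-1)\left(1+\sum_{j=1}^{m-1}\frac{2^{j-1}}{2^j-1}\right)\prod_{j=1}^{m-2}(2^j-1)^{2^{m-j}}.$$
   Context: For $n\ge1$, $\mathcal{H}(n,1)=\det[s(i+j)]_{0\le i,j<n}$, where $s(m)$ is the sum of the binary digits of $m\ge 0$. Empty products equal $1$. *)

(* Defs.v *)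
From mathcomp Require Import all_boot all_order all_algebra.

Set Implicit Arguments.
Unset Strict Implicit.
Unset Printing Implicit Defensive.

Import GRing.Theory.
Local Open Scope ring_scope.

(* The coefficient of 2 ^ i in the binary expansion of k is (k %/ 2 ^ i) %% 2;
   since k < 2 ^ k, all the digits with index i >= k vanish. *)
Definition bin_digit_sum (k : nat) : nat :=
  (\sum_(0 <= i < k) (k %/ 2 ^ i) %% 2)%N.

(* H(n, 1); the Hankel matrix has integer entries, so the value is an int. *)
Definition hankel_digit_sum (n : nat) : int :=
  \det (\matrix_(i < n, j < n) (bin_digit_sum (i + j)%N)%:Z).

(* Main.v *)
Require Import Defs.
From mathcomp Require Import all_boot all_order all_algebra.
From mathcomp Require Import perm ring zify lra.

Set Implicit Arguments.
Unset Strict Implicit.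
Unset Printing Implicit Defensive.

Import Order.TTheory GRing.Theory Num.Theory.
Local Open Scope ring_scope.

(** Put d(k) = s(k+1) - s(k), and let S_n = [s(i+j)] and D_n = [d(i+j)] be the
    Hankel matrices of order n; J is an all-ones block and e an all-ones column.
    The proof computes the perturbed determinants det (S_n + x J), whose
    recursion closes up, and sets x = 0 at the end.

    Listing the even indices before the odd ones and using s(2k) = s(k) and
    s(2k+1) = s(k) + 1 splits S_{p+q} + x J, where q <= p <= q+1, into the
    blocks S_p + x J, S_{p,q} + (x+1) J and [s(i+j+1)]_q + x J. Subtracting the
    even rows and columns from the odd ones leaves
<<
      S_p + x J         J
          J         D_q - 2 J
>>
    and if (D_q - 2 J) v = e then eliminating the off-diagonal J gives
<<
      det (S_{p+q} + x J) = det (D_q - 2 J) det (S_p + (x - e^T v) J).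
>>
    So each halving only translates x ([det_digit_hankel_shift]).

    For q = 2^m the vector v is explicit: s(i + 2^m) = s(i) + 1 for i < 2^m, so
    the row sums of D_q telescope to 1, D_q e = e, and the translation is
    2^m / (2^(m+1) - 1). Iterating down to order 1 (for 2^m) or 2 (for 2^m + 1)
    accumulates the sum of the theorem ([det_sum_hankel_iter]). The product
    comes from det D_{2^m}: the same parity split turns D_{2n} into the blocks
    J, D_n - J, D_n - J, J, whose determinant is det D_n det (2 J - D_n), so
    that det D_{2^m} satisfies a squaring recursion
    ([det_diff_hankel_double], [det_diff_hankel_pow]).

    For order 2^m - 1, take p = n and q = n - 1 with n = 2^(m-1). Since
    d(2k) = 1, the matrix D_{n-1} - J vanishes at the positions of even i + j,
    and its order is odd, so it is singular; a suitably scaled kernel vector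
    serves as v, with e^T v = -1, and also relates det (D_{n-1} - 2 J) to
    det D_n ([singular_principal_shift]). *)

(** * Determinants of block matrices and of perturbations by all-ones blocks *)

Section Determinants.
Variable R : comNzRingType.

Definition ones m n : 'M[R]_(m, n) := const_mx 1.

Definition entry_sum n (v : 'cV[R]_n) : R := \sum_i v i 0.

Lemma mul_ones_col m n (v : 'cV[R]_n) : ones m n *m v = entry_sum v *: ones m 1.
Proof.
apply/matrixP => i j; rewrite !mxE mulr1 /entry_sum.
by apply: eq_bigr => k _; rewrite !mxE mul1r (ord1 j).
Qed.

Lemma ones_mul m n : ones m 1 *m ones 1 n = ones m n.
Proof. by apply/matrixP => i j; rewrite !mxE big_ord1 !mxE mulr1. Qed.

(** Schur complement in a form that asks for a solution [W] of a linear system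
    instead of the invertibility of the pivot block. *)
Lemma det_schur_dr p q (A : 'M[R]_p) (B : 'M[R]_(p, q)) C (Q : 'M[R]_q) W :
  Q *m W = C -> \det (block_mx A B C Q) = \det (A - B *m W) * \det Q.
Proof.
move=> <-.
have -> : block_mx A B (Q *m W) Q
        = block_mx (A - B *m W) B 0 Q *m block_mx 1%:M 0 W 1%:M.
  by rewrite mulmx_block !(mulmx1, mulmx0, mul0mx, add0r, addr0) subrK.
by rewrite det_mulmx det_ublock det_lblock !det1 !mulr1.
Qed.

Lemma det_schur_ul p q (A : 'M[R]_p) B (C : 'M[R]_(q, p)) (Q : 'M[R]_q) W :
  A *m W = B -> \det (block_mx A B C Q) = \det A * \det (Q - C *m W).
Proof.
move=> <-.
have -> : block_mx A (A *m W) C Q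
        = block_mx A 0 C (Q - C *m W) *m block_mx 1%:M W 0 1%:M.
  rewrite mulmx_block !(mulmx1, mulmx0, mul0mx, add0r, addr0).
  by rewrite addrC subrK.
by rewrite det_mulmx det_ublock det_lblock !det1 !mulr1.
Qed.

(** Matrix determinant lemma: both Schur complements of the bordered matrix
    with blocks 1, x e^T, - e, Q. *)
Lemma det_add_ones q (Q : 'M[R]_q) v x : Q *m v = ones q 1 ->
  \det (Q + x *: ones q q) = (1 + x * entry_sum v) * \det Q.
Proof.
move=> Qv.
have e1 := @det_schur_ul 1 q 1%:M (x *: ones 1 q) (- ones q 1) Q (x *: ones 1 q).
have e2 := @det_schur_dr 1 q 1%:M (x *: ones 1 q) (- ones q 1) Q (- v).
rewrite e1 ?mul1mx // in e2.
rewrite mulNmx -scalemxAr ones_mul opprK det1 mul1r in e2.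
rewrite e2 ?mulmxN ?Qv // opprK -scalemxAl mul_ones_col.
by rewrite det_mx11 !mxE mulr1.
Qed.

(** Eliminating a corner joined to the rest only by all-ones blocks changes the
    rest by a multiple of the all-ones matrix. *)
Lemma det_ones_border p q (A : 'M[R]_p) (Q : 'M[R]_q) v :
  Q *m v = ones q 1 ->
  \det (block_mx A (ones p q) (ones q p) Q)
  = \det (A - entry_sum v *: ones p p) * \det Q.
Proof.
move=> Qv; rewrite (@det_schur_dr _ _ _ _ _ _ (v *m ones 1 p)).
  by rewrite mulmxA mul_ones_col -scalemxAl ones_mul.
by rewrite mulmxA Qv ones_mul.
Qed.

(** Conjugation by the block matrix 1, 0, 1, 1 makes such a matrix block
    triangular, with P - Q and P + Q on the diagonal. *)
Lemma det_block_swap n (P Q : 'M[R]_n) :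
  \det (block_mx P Q Q P) = \det (P + Q) * \det (P - Q).
Proof.
have e : block_mx 1%:M 0 1%:M 1%:M *m block_mx P Q Q P
       = block_mx (P - Q) Q 0 (P + Q) *m block_mx 1%:M 0 1%:M 1%:M.
  rewrite !mulmx_block !(mulmx1, mul1mx, mulmx0, mul0mx, add0r, addr0) subrK.
  by rewrite (addrC Q).
have := congr1 determinant e.
by rewrite !det_mulmx !(det_lblock, det_ublock) !det1 !(mul1r, mulr1) mulrC.
Qed.

(** Conjugation by the signs (-1)^i changes M into - M. *)
Lemma det_checkerboard n (M : 'M[R]_n) :
  (forall i j : 'I_n, ~~ odd (i + j) -> M i j = 0) ->
  \det M = (-1) ^+ n * \det M.
Proof.
move=> M0; pose s := diag_mx (\row_(i < n) (-1) ^+ i) : 'M[R]_n.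
have sM : s *m M = (- 1)%:M *m (M *m s).
  rewrite mul_diag_mx mul_mx_diag mul_scalar_mx; apply/matrixP => i j.
  rewrite !mxE; have [ij|/M0->] := boolP (odd (i + j)); last first.
    by rewrite !(mulr0, mul0r).
  rewrite -[X in X * _ = _]signr_odd -[X in _ = _ * (_ * X)]signr_odd.
  have -> : odd i = ~~ odd j by move: ij; rewrite oddD; do 2! case: odd.
  by case: odd; rewrite /= ?expr0 ?expr1; ring.
have ss : s *m s = 1%:M.
  rewrite mulmx_diag; apply/matrixP => i j.
  by rewrite !mxE -expr2 sqrr_sign.
rewrite -[M in LHS]mul1mx -ss -mulmxA sM !det_mulmx det_scalar.
have /(congr1 determinant) := ss; rewrite det_mulmx det1 => ds.
by rewrite mulrCA [\det s * _]mulrC -mulrA ds mulr1.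
Qed.

End Determinants.

(** * Splitting a matrix by the parity of its indices *)

Section ParitySplit.
Variable R : comNzRingType.

Definition parity_shuffle p q (k : 'I_(p + q)) : nat :=
  match split k with inl i => i.*2 | inr j => j.*2.+1 end.

Lemma parity_shuffle_lt p q (k : 'I_(p + q)) : (q <= p <= q.+1)%N ->
  (parity_shuffle k < p + q)%N.
Proof.
move=> /andP[qp pq1]; rewrite /parity_shuffle.
by case: split => i; have := ltn_ord i; lia.
Qed.

Lemma parity_shuffle_inj p q : injective (@parity_shuffle p q).
Proof.
move=> k l; rewrite /parity_shuffle -{2}(splitK k) -{2}(splitK l).
case: (split k) => i; case: (split l) => j e; try lia.
  by congr (unsplit (inl _)); apply: val_inj => /=; lia.
by congr (unsplit (inr _)); apply: val_inj => /=; lia.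
Qed.

Lemma det_parity_split p q (F : nat -> nat -> R) : (q <= p <= q.+1)%N ->
  \det (\matrix_(i < p + q, j < p + q) F i j) =
  \det (block_mx (\matrix_(i < p, j < p) F i.*2 j.*2)
                 (\matrix_(i < p, j < q) F i.*2 j.*2.+1)
                 (\matrix_(i < q, j < p) F i.*2.+1 j.*2)
                 (\matrix_(i < q, j < q) F i.*2.+1 j.*2.+1)).
Proof.
move=> pq; pose f k := Ordinal (@parity_shuffle_lt p q k pq).
have f_inj : injective f by move=> k l /(congr1 val) /parity_shuffle_inj.
pose s := perm f_inj; set M := \matrix_(i, j) _.
transitivity (\det (row_perm s (col_perm s M))).
  rewrite row_permE col_permE !det_mulmx !det_perm odd_permV mulrCA.
  by rewrite -signr_addb addbb mulr1.
congr (\det _); apply/matrixP => k l; rewrite -(splitK k) -(splitK l).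
case: (split k) => i; case: (split l) => j;
  rewrite ?(block_mxEul, block_mxEur, block_mxEdl, block_mxEdr) !mxE /=;
  rewrite !permE /= /parity_shuffle.
all: by rewrite -?/(unsplit (inl _)) -?/(unsplit (inr _)) !unsplitK.
Qed.

(** Right multiplication by [select p q] keeps the first [q] columns out of [p];
    it pairs the odd index 2j+1 with the even index 2j after the split. *)
Definition select p q : 'M[R]_(p, q) := \matrix_(i, j) (i == j :> nat)%:R.

Lemma mul_select r p q (F : nat -> nat -> R) : (q <= p)%N ->
  (\matrix_(i < r, k < p) F i k) *m select p q = \matrix_(i, j) F i j.
Proof.
move=> qp; apply/matrixP => i j; rewrite !mxE (bigD1 (widen_ord qp j)) //=.
rewrite !mxE eqxx mulr1 big1 ?addr0 // => k kj.
by rewrite !mxE (negbTE kj : (k == j :> nat) = false) mulr0.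
Qed.

Lemma select_mul r p q (F : nat -> nat -> R) : (q <= p)%N ->
  (select p q)^T *m (\matrix_(k < p, i < r) F k i) = \matrix_(j, i) F j i.
Proof.
move=> qp; apply/matrixP => i j; rewrite !mxE (bigD1 (widen_ord qp i)) //=.
rewrite !mxE eqxx mul1r big1 ?addr0 // => k kj.
by rewrite !mxE (negbTE kj : (k == i :> nat) = false) mul0r.
Qed.

End ParitySplit.

(** * Halving the Hankel matrix of a digit sum *)

Section Hankel.
Variable R : comNzRingType.

Definition hankel (a : nat -> R) n : 'M[R]_n := \matrix_(i, j) a (i + j)%N.

(** After the parity split, subtracting the even rows and columns from the odd
    ones leaves in the last corner a(k+1) - (a(k) + 1) - (a(k) + 1) + a(k) at
    k = i + j. The functional equations leave a(0) free, hence the later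
    freedom to add a constant to [a]. *)
Lemma det_digit_hankel_split (a : nat -> R) p q :
  (forall k, a k.*2 = a k) -> (forall k, a k.*2.+1 = a k + 1) ->
  (q <= p <= q.+1)%N ->
  \det (hankel a (p + q)) =
  \det (block_mx (hankel a p) (ones R p q) (ones R q p)
     (hankel (fun k => a k.+1 - a k) q - 2 *: ones R q q)).
Proof.
move=> ae ao pq; have qp : (q <= p)%N by case/andP: pq.
rewrite /hankel (det_parity_split (fun i j => a (i + j)%N)) //.
set B := block_mx _ _ _ (_ - _).
pose T := select R p q.
(* the factors with [T] add each even row and column back to the next odd one *)
transitivity (\det (block_mx 1%:M 0 T^T 1%:M *m B *m block_mx 1%:M T 0 1%:M));
  last by rewrite !det_mulmx det_lblock det_ublock !det1 !mulr1 mul1r.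
congr (\det _).
rewrite !mulmx_block !(mulmx1, mul1mx, mulmx0, mul0mx, add0r, addr0).
have aT r : (\matrix_(i < r, k < p) a (i + k)%N) *m T = \matrix_(i, j) a (i + j)%N.
  exact: (@mul_select _ _ _ _ (fun i k => a (i + k)%N)).
have Ta r : T^T *m (\matrix_(k < p, i < r) a (k + i)%N) = \matrix_(j, i) a (j + i)%N.
  exact: (@select_mul _ _ _ _ (fun i k => a (i + k)%N)).
have onesE k l : ones R k l = \matrix_(i, j) 1.
  by apply/matrixP => i j; rewrite !mxE.
have oneT : ones R q p *m T = ones R q q.
  rewrite !onesE; exact: (@mul_select _ _ _ _ (fun _ _ => 1)).
have Tone : T^T *m ones R p q = ones R q q.
  rewrite !onesE; exact: (@select_mul _ _ _ _ (fun _ _ => 1)).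
rewrite !mulmxDl Ta !aT oneT Tone.
congr block_mx; apply/matrixP => i j; rewrite !mxE.
- by rewrite -doubleD ae.
- by rewrite addnS -doubleD ao.
- by rewrite addSn -doubleD ao.
by rewrite addSn addnS -doubleD -doubleS ae; ring.
Qed.

(** Adding [x] to [a] preserves both functional equations and the differences,
    so the split applies to the perturbed matrix, and its corner of order [q],
    independent of [x], can be eliminated. *)
Lemma det_digit_hankel_shift (a : nat -> R) p q v x :
  (forall k, a k.*2 = a k) -> (forall k, a k.*2.+1 = a k + 1) ->
  (q <= p <= q.+1)%N ->
  (hankel (fun k => a k.+1 - a k) q - 2 *: ones R q q) *m v = ones R q 1 ->
  \det (hankel (fun k => a k + x) (p + q)) =
  \det (hankel (fun k => a k.+1 - a k) q - 2 *: ones R q q)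
  * \det (hankel (fun k => a k + (x - entry_sum v)) p).
Proof.
move=> ae ao pq Qv; rewrite det_digit_hankel_split => // [|k|k]; last 2 first.
- by rewrite ae.
- by rewrite ao addrAC.
have -> : hankel (fun k => a k.+1 + x - (a k + x)) q
        = hankel (fun k => a k.+1 - a k) q.
  by apply/matrixP => i j; rewrite !mxE; ring.
rewrite (det_ones_border _ Qv) mulrC; congr (_ * \det _).
by apply/matrixP => i j; rewrite !mxE; ring.
Qed.

End Hankel.

(** * Leading principal submatrix of a symmetric matrix with unit row sums *)

Section Principal.
Variable F : fieldType.

Lemma det0_colP n (M : 'M[F]_n) :
  reflect (exists2 v : 'cV[F]_n, v != 0 & M *m v = 0) (\det M == 0).
Proof.
have tr0 m1 n1 (A : 'M[F]_(m1, n1)) : (A^T == 0) = (A == 0).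
  by rewrite -(inj_eq (can_inj (@trmxK _ _ _))) trmxK trmx0.
rewrite -det_tr; apply: (iffP det0P) => [] [v v0 Mv].
  exists v^T; first by rewrite tr0.
  by rewrite -[M]trmxK -trmx_mul Mv trmx0.
by exists v^T; [rewrite tr0 | rewrite -trmx_mul Mv trmx0].
Qed.

(** A kernel vector v0 of D - J, where D is the leading block, satisfies
    D v0 = (e^T v0) e. If e^T v0 were 0, then v0 extended by 0 would be in the
    kernel of M; so v0 can be scaled to a v with e^T v = -1 and D v = - e. For
    the determinant, replace the last column of M by M applied to v + e
    extended by 1: this is zero except for its last entry, which is n. Hence
    det M = n det D, and det D = - det (D - 2 J) by [det_add_ones]. *)
Lemma singular_principal_shift n (M : 'M[F]_(n + 1)) :
  M^T = M -> M *m ones F _ 1 = ones F _ 1 -> \det M != 0 ->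
  \det (ulsubmx M - ones F n n) = 0 ->
  exists v, [/\ (ulsubmx M - 2 *: ones F n n) *m v = ones F n 1,
    entry_sum v = -1 & \det M = - n%:R * \det (ulsubmx M - 2 *: ones F n n)].
Proof.
move=> Msym Me Mn0 D0.
pose D := ulsubmx M; pose c := ursubmx M; pose r := dlsubmx M.
pose w := drsubmx M.
have ME : M = block_mx D c r w by rewrite submxK.
have oneE k : ones F (n + 1) k = col_mx (ones F n k) (ones F 1 k).
  by rewrite /ones col_mx_const.
have [De re] : D *m ones F n 1 + c = ones F n 1 /\
               r *m ones F n 1 + w = ones F 1 1.
  move: Me; rewrite ME oneE mul_block_col => /eq_col_mx[].
  have -> : ones F 1 1 = 1%:M.
    by apply/matrixP => i j; rewrite !mxE (ord1 i) (ord1 j).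
  by rewrite !mulmx1.
have [Dsym rc] : D^T = D /\ r = c^T.
  by move: Msym; rewrite ME tr_block_mx => /eq_block_mx[-> _ -> _].
have rE : r = ones F 1 n - ones F 1 n *m D.
  rewrite rc -[c](addKr (D *m ones F n 1)) De addrC linearB /= trmx_mul Dsym.
  by rewrite !trmx_const.
have [v0 v0n0] : exists2 v : 'cV[F]_n, v != 0 & (D - ones F n n) *m v = 0.
  by apply/det0_colP/eqP.
move/eqP; rewrite mulmxBl subr_eq0 mul_ones_col => /eqP Dv0.
have s0 : entry_sum v0 != 0.
  apply: contraNneq Mn0 => s0; rewrite s0 scale0r in Dv0.
  apply/det0_colP; exists (col_mx v0 0); first by rewrite col_mx_eq0 negb_and v0n0.
  rewrite ME mul_block_col !mulmx0 !addr0 Dv0 rE mulmxBl -mulmxA Dv0 mulmx0.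
  by rewrite subr0 mul_ones_col s0 scale0r col_mx0.
pose v := - (entry_sum v0)^-1 *: v0.
have sv : entry_sum v = -1.
  rewrite /entry_sum /v; under eq_bigr do rewrite mxE.
  by rewrite -mulr_sumr mulNr mulVf.
have Dv : D *m v = - ones F n 1.
  by rewrite -scalemxAr Dv0 scalerA mulNr mulVf // scaleN1r.
have Qv : (D - 2 *: ones F n n) *m v = ones F n 1.
  rewrite mulmxBl Dv -scalemxAl mul_ones_col sv scalerA mulrN1 scaleNr opprK.
  by rewrite scaler_nat mulr2n addKr.
exists v; split => //.
have DQ : \det D = - \det (D - 2 *: ones F n n).
  rewrite -[D in LHS](subrK (2 *: ones F n n)) (det_add_ones _ Qv) sv; ring.
have e : M *m block_mx 1%:M (ones F n 1 + v) 0 1%:M = block_mx D 0 r (n%:R)%:M.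
  rewrite {1}ME mulmx_block !(mulmx1, mulmx0, addr0) !mulmxDr.
  rewrite Dv addrAC De subrr addrAC re; congr block_mx.
  rewrite rE mulmxBl -mulmxA Dv mulmxN opprK !mul_ones_col sv.
  rewrite /entry_sum; under eq_bigr do rewrite mxE.
  rewrite sumr_const card_ord; apply/matrixP => i j.
  by rewrite !mxE (ord1 i) (ord1 j) !mulr1 addrA subrr add0r.
have := congr1 determinant e.
rewrite det_mulmx det_ublock det_lblock !det1 !mulr1 det_scalar1 => ->.
by rewrite DQ -/D; ring.
Qed.

End Principal.

(** * The binary digit sum *)

Lemma bin_digit_sum_wide k K : (k <= K)%N ->
  bin_digit_sum k = (\sum_(0 <= i < K) (k %/ 2 ^ i) %% 2)%N.
Proof.
move=> kK; rewrite (big_cat_nat (n := k)) //= [X in (_ + X)%N]big_nat.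
rewrite [X in (_ + X)%N]big1 ?addn0 //.
move=> i /andP[ki _]; rewrite divn_small //.
by rewrite (leq_trans (ltn_expl k (ltnSn 1))) // leq_exp2l.
Qed.

Lemma bin_digit_sum_cons (b : bool) k :
  bin_digit_sum (b + k.*2) = (b + bin_digit_sum k)%N.
Proof.
rewrite (@bin_digit_sum_wide _ (b + k.*2).+1) // big_nat_recl //=.
rewrite divn1 modn2 oddD odd_double addbF oddb; congr addn.
rewrite (@bin_digit_sum_wide k (b + k.*2)); last by lia.
by apply: eq_bigr => i _; rewrite expnS divnMA divn2 half_bit_double.
Qed.

Lemma bin_digit_sum_double k : bin_digit_sum k.*2 = bin_digit_sum k.
Proof. exact: (bin_digit_sum_cons false). Qed.

Lemma bin_digit_sum_doubleS k : bin_digit_sum k.*2.+1 = (bin_digit_sum k).+1.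
Proof. exact: (bin_digit_sum_cons true). Qed.

Lemma bin_digit_sum_add_pow m i : (i < 2 ^ m)%N ->
  bin_digit_sum (i + 2 ^ m) = (bin_digit_sum i).+1.
Proof.
elim: m i => [|m IHm] i.
  by rewrite expn0 ltnS leqn0 => /eqP->; rewrite /bin_digit_sum !unlock.
rewrite expnS mul2n => ltim; set b := odd i; set h := i./2.
have -> : i = (b + h.*2)%N by rewrite odd_double_half.
by rewrite -addnA -doubleD !bin_digit_sum_cons IHm ?addnS // /h; lia.
Qed.

Definition digit_sum k : rat := (bin_digit_sum k)%:R.
Definition digit_diff k : rat := digit_sum k.+1 - digit_sum k.

Local Notation sum_hankel n x := (hankel (fun k => digit_sum k + x) n).
Local Notation diff_hankel n := (hankel digit_diff n).
Local Notation J n := (ones rat n n).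

Lemma digit_sum_double k : digit_sum k.*2 = digit_sum k.
Proof. by rewrite /digit_sum bin_digit_sum_double. Qed.

Lemma digit_sum_doubleS k : digit_sum k.*2.+1 = digit_sum k + 1.
Proof. by rewrite /digit_sum bin_digit_sum_doubleS -natr1. Qed.

Lemma digit_diff_double k : digit_diff k.*2 = 1.
Proof. by rewrite /digit_diff digit_sum_double digit_sum_doubleS addrC addKr. Qed.

Lemma digit_diff_doubleS k : digit_diff k.*2.+1 = digit_diff k - 1.
Proof.
by rewrite /digit_diff -doubleS digit_sum_double digit_sum_doubleS opprD addrA.
Qed.

Lemma hankel_digit_sumE n : (hankel_digit_sum n)%:~R = \det (sum_hankel n 0).
Proof.
rewrite /hankel_digit_sum -det_map_mx; congr (\det _).
by apply/matrixP => i j; rewrite !mxE addr0.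
Qed.

(** * Differences of the digit sum in order 2^m *)

(** The sum of s(i+j+1) - s(i+j) over j < 2^m telescopes to
    s(i + 2^m) - s(i), and adding 2^m to i < 2^m adds a digit 1. *)
Lemma diff_hankel_ones m : diff_hankel (2 ^ m) *m ones rat _ 1 = ones rat _ 1.
Proof.
apply/matrixP => i j; rewrite !mxE.
under eq_bigr do rewrite !mxE mulr1 /digit_diff -addnS.
rewrite -(big_mkord xpredT (fun k => digit_sum (i + k.+1) - digit_sum (i + k))).
rewrite telescope_sumr // addn0 /digit_sum bin_digit_sum_add_pow //.
by rewrite -natr1 addrC addKr.
Qed.

Lemma entry_sum_scale_ones n (a : rat) : entry_sum (a *: ones rat n 1) = a * n%:R.
Proof.
rewrite /entry_sum; under eq_bigr do rewrite !mxE mulr1.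
by rewrite sumr_const card_ord mulr_natr.
Qed.

Lemma entry_sum_ones n : entry_sum (ones rat n 1) = n%:R.
Proof. by rewrite -[ones _ _ _]scale1r entry_sum_scale_ones mul1r. Qed.

Lemma det_diff_hankel_add m x :
  \det (diff_hankel (2 ^ m) + x *: J _) = (1 + x * 2 ^+ m) * \det (diff_hankel (2 ^ m)).
Proof.
rewrite (det_add_ones _ (diff_hankel_ones m)).
by rewrite entry_sum_ones natrX.
Qed.

Lemma pow2_gt1 j : (0 < j)%N -> 1 < 2 ^+ j :> rat.
Proof. by move=> j0; rewrite exprn_egt1 // -lt0n. Qed.

(** By d(2k) = 1 and d(2k+1) = d(k) - 1, the parity split gives the blocks
    J, D - J, D - J, J. *)
Lemma det_diff_hankel_double m :
  \det (diff_hankel (2 ^ m.+1)) =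
  (-1) ^+ (2 ^ m) * (1 - 2 ^+ m.+1) * \det (diff_hankel (2 ^ m)) ^+ 2.
Proof.
rewrite expnS mul2n -addnn /hankel.
rewrite (det_parity_split (fun i j => digit_diff (i + j)%N)) ?leqnn ?leqnSn //.
transitivity (\det (block_mx (J (2 ^ m)) (diff_hankel (2 ^ m) - J _)
                             (diff_hankel (2 ^ m) - J _) (J _))).
  congr (\det _); congr block_mx; apply/matrixP => i j; rewrite !mxE.
  - by rewrite -doubleD digit_diff_double.
  - by rewrite addnS -doubleD digit_diff_doubleS.
  - by rewrite addSn -doubleD digit_diff_doubleS.
  by rewrite addSn addnS -doubleD -doubleS digit_diff_double.
rewrite det_block_swap addrC subrK.
have -> : J (2 ^ m) - (diff_hankel _ - J _) = -1 *: (diff_hankel (2 ^ m) + (-2) *: J _).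
  by apply/matrixP => i j; rewrite !mxE; ring.
rewrite detZ det_diff_hankel_add exprS; ring.
Qed.

Lemma det_diff_hankel1 : \det (diff_hankel 1) = 1.
Proof. by rewrite det_mx11 mxE (digit_diff_double 0). Qed.

(** From order 2 on, the sign in [det_diff_hankel_double] is 1. *)
Lemma det_diff_hankel_doubleS m :
  \det (diff_hankel (2 ^ m.+2)) =
  - (2 ^+ m.+2 - 1) * \det (diff_hankel (2 ^ m.+1)) ^+ 2.
Proof.
by rewrite det_diff_hankel_double -signr_odd oddX expr0 mul1r opprB.
Qed.

(** Squaring gives a formula valid from order 2 on; there the determinant is 1,
    whereas the signed formula of [det_diff_hankel_pow] would give -1. *)
Lemma det_diff_hankel_sqr m :
  \det (diff_hankel (2 ^ m.+1)) ^+ 2 =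
  \prod_(1 <= j < m.+2) (2 ^+ j - 1) ^+ (2 ^ (m.+2 - j)).
Proof.
elim: m => [|m IHm].
  by rewrite det_diff_hankel_double det_diff_hankel1 big_nat1.
rewrite det_diff_hankel_doubleS exprMn sqrrN IHm [in RHS]big_nat_recr //= mulrC.
rewrite subSnn expn1 -prodrXl; congr (_ * _).
apply: eq_big_nat => j /andP[_ jm].
by rewrite -exprM -expnSr -subSn // ltnW.
Qed.

Lemma det_diff_hankel_pow m :
  \det (diff_hankel (2 ^ m.+2)) =
  - \prod_(1 <= j < m.+3) (2 ^+ j - 1) ^+ (2 ^ (m.+2 - j)).
Proof.
rewrite det_diff_hankel_doubleS det_diff_hankel_sqr [in RHS]big_nat_recr //=.
by rewrite subnn expr1 mulNr mulrC.
Qed.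

Lemma det_diff_hankel_neq0 m : \det (diff_hankel (2 ^ m)) != 0.
Proof.
elim: m => [|m IHm].
  by rewrite det_diff_hankel1.
rewrite det_diff_hankel_double !mulf_neq0 ?expf_neq0 //.
by rewrite subr_eq0 lt_eqF // pow2_gt1.
Qed.

(** * Hankel determinants of the digit sum *)

(** Here [det_digit_hankel_shift] is used with v = e / (1 - 2^(m+1)), because
    D e = e and J e = 2^m e in order 2^m. *)
Lemma det_sum_hankel_halve m p x : (2 ^ m <= p <= (2 ^ m).+1)%N ->
  \det (sum_hankel (p + 2 ^ m) x) =
  (1 - 2 ^+ m.+1) * \det (diff_hankel (2 ^ m))
  * \det (sum_hankel p (x + 2 ^+ m / (2 ^+ m.+1 - 1))).
Proof.
move=> pm; have n0 : 1 - 2 ^+ m.+1 != 0 :> rat.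
  by rewrite subr_eq0 lt_eqF // pow2_gt1.
have Dv : (diff_hankel (2 ^ m) - 2 *: J _)
          *m ((1 - 2 ^+ m.+1)^-1 *: ones rat _ 1) = ones rat _ 1.
  rewrite -scalemxAr mulmxBl diff_hankel_ones -scalemxAl mul_ones_col.
  rewrite entry_sum_ones scalerA natrX -exprS.
  by rewrite -[X in _ *: (X - _)]scale1r -scalerBl scalerA mulVf // scale1r.
rewrite (det_digit_hankel_shift _ digit_sum_double digit_sum_doubleS pm Dv).
rewrite entry_sum_scale_ones natrX -scaleNr det_diff_hankel_add.
have E : 2 ^+ m / (2 ^+ m.+1 - 1) = - ((1 - 2 ^+ m.+1)^-1 * 2 ^+ m) :> rat.
  by rewrite -mulNr -invrN opprB mulrC.
by rewrite E exprS mulNr.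
Qed.

(** The total translation of [x] when the order 2^m is halved down to 1. *)
Definition total_shift m : rat := \sum_(1 <= j < m.+1) 2 ^+ (j - 1) / (2 ^+ j - 1).

Lemma total_shiftS m : total_shift m.+1 = total_shift m + 2 ^+ m / (2 ^+ m.+1 - 1).
Proof. by rewrite /total_shift big_nat_recr //= subn1. Qed.

(** Each halving contributes the factor (1 - 2^(k+1)) det D_{2^k}; by
    [det_diff_hankel_double] these factors multiply up to - det D_{2^(m+1)}.
    Taking d = 0 or d = 1 leaves a determinant of order 1 or 2. *)
Lemma det_sum_hankel_iter m d (x : rat) : (d <= 1)%N ->
  \det (sum_hankel (2 ^ m.+1 + d) x) =
  - \det (diff_hankel (2 ^ m.+1)) * \det (sum_hankel (1 + d) (x + total_shift m.+1)).
Proof.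
move=> d1.
have step k (y : rat) : \det (sum_hankel (2 ^ k.+1 + d) y) =
    (1 - 2 ^+ k.+1) * \det (diff_hankel (2 ^ k))
    * \det (sum_hankel (2 ^ k + d) (y + 2 ^+ k / (2 ^+ k.+1 - 1))).
  rewrite -det_sum_hankel_halve; last by lia.
  by rewrite expnS mul2n -addnn -addnA addnC.
elim: m x => [|m IHm] x.
  rewrite step det_diff_hankel_double total_shiftS /total_shift big_geq //.
  by rewrite add0r expn0 det_diff_hankel1; ring.
rewrite step IHm [in RHS]det_diff_hankel_double [total_shift m.+2]total_shiftS.
rewrite -[in RHS]signr_odd oddX /= expr0 [total_shift _ + _ in RHS]addrC addrA; ring.
Qed.

(** As d(2k) = 1, the matrix D - J of odd order 2^(m+1) - 1 is zero wherever
    i + j is even, so [det_checkerboard] makes it singular. *)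
Lemma det_diff_hankel_pred m : exists2 v,
  (diff_hankel (2 ^ m.+1 - 1) - 2 *: J _) *m v = ones rat _ 1 &
  entry_sum v = -1 /\
  \det (diff_hankel (2 ^ m.+1)) =
  - (2 ^+ m.+1 - 1) * \det (diff_hankel (2 ^ m.+1 - 1) - 2 *: J _).
Proof.
have pos : (0 < 2 ^ m.+1)%N by rewrite expn_gt0.
have row := diff_hankel_ones m.+1.
have nz := det_diff_hankel_neq0 m.+1.
have nE : (2 ^+ m.+1 - 1 : rat) = (2 ^ m.+1 - 1)%N%:R by rewrite natrB // natrX.
have on : odd (2 ^ m.+1 - 1) by rewrite oddB // oddX.
rewrite nE; move: on row nz (subnK pos).
move: (2 ^ m.+1 - 1)%N => n on row nz e; rewrite -e in row nz *.
have uE : ulsubmx (diff_hankel (n + 1)) = diff_hankel n.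
  by apply/matrixP => i j; rewrite !mxE.
have [||v [Qv sv dE]] := singular_principal_shift _ row nz.
- by apply/matrixP => i j; rewrite !mxE addnC.
- rewrite uE; suff: \det (diff_hankel n - J n) = - \det (diff_hankel n - J n) by lra.
  rewrite {1}det_checkerboard; first by rewrite -signr_odd on expr1 mulN1r.
  move=> i j /negbTE ij.
  by rewrite !mxE -(odd_double_half (i + j)) ij digit_diff_double subrr.
by rewrite uE in Qv dE; exists v.
Qed.

Theorem proposition4p5 (m : nat) (hm : (2 <= m)%N) :
  [/\ (hankel_digit_sum (2 ^ m))%:~R =
        (\sum_(1 <= j < m.+1) 2 ^+ (j - 1) / (2 ^+ j - 1))
        * \prod_(1 <= j < m.+1) (2 ^+ j - 1) ^+ (2 ^ (m - j)) :> rat,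
      (hankel_digit_sum (2 ^ m + 1))%:~R =
        - (1 + \sum_(1 <= j < m.+1) 2 ^+ (j - 1) / (2 ^+ j - 1))
        * \prod_(1 <= j < m.+1) (2 ^+ j - 1) ^+ (2 ^ (m - j)) :> rat
    & (hankel_digit_sum (2 ^ m - 1))%:~R =
        (2 ^+ (m - 1) - 1)
        * (1 + \sum_(1 <= j < (m - 1).+1) 2 ^+ (j - 1) / (2 ^+ j - 1))
        * \prod_(1 <= j < (m - 2).+1) (2 ^+ j - 1) ^+ (2 ^ (m - j)) :> rat].
Proof.
case: m hm => [//|[//|m]] _; rewrite !hankel_digit_sumE.
have H1 x : \det (sum_hankel 1 x) = x.
  by rewrite det_mx11 !mxE /digit_sum /bin_digit_sum big_geq // add0r.
have H2 x : \det (sum_hankel (1 + 1) x) = - (1 + x).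
  by rewrite (@det_sum_hankel_halve 0 1) // H1 det_diff_hankel1 expr1 expr0; field.
split.
- rewrite -[(2 ^ _)%N]addn0 det_sum_hankel_iter // H1 det_diff_hankel_pow.
  by rewrite add0r opprK mulrC.
- by rewrite det_sum_hankel_iter // H2 det_diff_hankel_pow add0r opprK mulrC.
rewrite !subSS !subn0.
have [v Qv [sv dE]] := det_diff_hankel_pred m.
have pos : (0 < 2 ^ m.+1)%N by rewrite expn_gt0.
have -> : (2 ^ m.+2 - 1 = 2 ^ m.+1 + (2 ^ m.+1 - 1))%N.
  by rewrite [(2 ^ m.+2)%N]expnS mul2n -addnn addnBA.
rewrite (det_digit_hankel_shift _ digit_sum_double digit_sum_doubleS _ Qv); last by lia.
have := @det_sum_hankel_iter m 0 1 isT; rewrite !addn0 sv opprK add0r H1 => ->.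
rewrite -/(total_shift m.+1).
have p0 : 2 ^+ m.+1 - 1 != 0 :> rat by rewrite subr_eq0 gt_eqF // pow2_gt1.
have pQ : \det (diff_hankel (2 ^ m.+1 - 1) - 2 *: J _)
        = - \det (diff_hankel (2 ^ m.+1)) / (2 ^+ m.+1 - 1).
  by rewrite dE !mulNr opprK mulrC mulKf.
rewrite [X in X * _ = _]pQ.
transitivity (\det (diff_hankel (2 ^ m.+1)) ^+ 2
              * (1 + total_shift m.+1) / (2 ^+ m.+1 - 1)).
  by field.
by rewrite det_diff_hankel_sqr big_nat_recr //= subSnn expn1; field.
Qed.
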